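(* Let $A \in \mathbb{C}^{m \times n}$ be a nonzero matrix, let $r_1,\dots,r_m \in \mathbb{C}^n$ denote the conjugate transposes of the $m$ rows of $A$, let $r_j$ be one of these vectors with the largest Euclidean norm, let $v \in \mathbb{C}^n$ be a right singular vector of $A$ corresponding to its largest singular value, let $y \in \mathbb{C}^n$, $y \neq 0$, achieve the $1\to q$ norm of $A$ (i.e. $\|Ay\|_q/\|y\|_1 = \|A\|_{1\to q}$), and let $S = \{v, r_1, \dots, r_m\}$. Then for all $1 \le p \le 2 \le q$, $$\max_{\substack{x \in S\cup\{y\} \\ x \ne 0}} \frac{\|Ax\|_q}{\|x\|_p} \;\ge\; \left[\frac{\|y\|_1}{\|y\|_p}\right]^{\frac{2-p}{p}} \left( \left[\frac{\|Ar_j\|_q}{2\|Ar_j\|_\infty}\right]^{\frac{q-2}{2(q-1)}} \left[\frac{\|Av\|_q}{\|Av\|_2}\right]^{\frac{1}{q-1}} \min_{\substack{x \in S \\ x \ne 0}} \frac{\|x\|_2}{\|x\|_p}\right)^{\frac{2(p-1)}{p}} \|A\|_{p\to q},$$ and for all $p,q \ge 2$, $$\max_{\substack{x \in S \\ x \ne 0}} \frac{\|Ax\|_q}{\|x\|_p} \;\ge\; n^{\frac{2-p}{2p}} \left( \left[\frac{\|Ar_j\|_q}{2\|Ar_j\|_\infty}\right]^{\frac{q-2}{2(q-1)}} \left[\frac{\|Av\|_q}{\|Av\|_2}\right]^{\frac{1}{q-1}} \min_{\substack{x \in S \\ x \ne 0}} \frac{\|x\|_2}{\|x\|_p}\right)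 \|A\|_{p\to q}.$$
   Context: For $A \in \mathbb{C}^{m\times n}$ and $p,q \in [1,\infty]$, the matrix $p\to q$ norm is $\|A\|_{p\to q} = \max_{x \in \mathbb{C}^n, x\neq 0} \|Ax\|_q/\|x\|_p$, where $\|\cdot\|_p$ is the usual $\ell_p$ norm on vectors. *)

(* Defs.v *)
From mathcomp Require Import all_boot all_order all_algebra.
From mathcomp Require Import spectral.
From mathcomp Require Import complex.
From mathcomp Require Import all_classical all_reals all_analysis.

Set Implicit Arguments.
Unset Strict Implicit.
Unset Printing Implicit Defensive.

Import Order.TTheory GRing.Theory Num.Theory.

Local Open Scope classical_set_scope.
Local Open Scope sesquilinear_scope.
Local Open Scope complex_scope.
Local Open Scope ring_scope.

(* [normc] is the modulus with values in [R], whereas the generic norm of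
   [R[i]] takes values in [R[i]]. Only exponents in [1, +oo] are meaningful. *)
Definition lpnorm (R : realType) (n : nat) (p : \bar R) (x : 'cV[R[i]]_n) : R :=
  match p with
  | s%:E => (\sum_(i < n) (Normc.normc (x i ord0)) `^ s) `^ s^-1
  | +oo%E => \big[Num.max/0]_(i < n) Normc.normc (x i ord0)
  | -oo%E => 0
  end.

Definition gain (R : realType) (m n : nat) (A : 'M[R[i]]_(m, n)) (p q : \bar R)
    (x : 'cV[R[i]]_n) : R :=
  lpnorm q (A *m x) / lpnorm p x.

(* The supremum is a maximum when 0 < n and p, q >= 1, since the gain is
   continuous and scale invariant, hence given by its values on a sphere. *)
Definition opnorm (R : realType) (m n : nat) (A : 'M[R[i]]_(m, n))
    (p q : \bar R) : R :=
  sup [set gain A p q x | x in [set x : 'cV[R[i]]_n | x != 0]].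

Definition rowvec (R : realType) (m n : nat) (A : 'M[R[i]]_(m, n)) (i : 'I_m) :
    'cV[R[i]]_n :=
  (row i A)^t*.

(* u and v are not normalized; for s > 0 the equations force them to have the
   same Euclidean norm. *)
Definition singular_triple (R : realType) (m n : nat) (A : 'M[R[i]]_(m, n))
    (s : R) (u : 'cV[R[i]]_m) (v : 'cV[R[i]]_n) : Prop :=
  [/\ 0 <= s, u != 0, v != 0, A *m v = s%:C *: u & A^t* *m u = s%:C *: v].

Definition singular_value (R : realType) (m n : nat) (A : 'M[R[i]]_(m, n))
    (s : R) : Prop :=
  exists u v, singular_triple A s u v.

Definition top_right_singular_vector (R : realType) (m n : nat)
    (A : 'M[R[i]]_(m, n)) (v : 'cV[R[i]]_n) : Prop :=
  exists s, (exists u, singular_triple A s u v) /\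
            (forall t, singular_value A t -> t <= s).

(* Maximum and minimum of a nonempty list of reals (0 for the empty list). *)
Definition max_seq (R : realType) (s : seq R) : R :=
  \big[Num.max/head 0 s]_(a <- s) a.

Definition min_seq (R : realType) (s : seq R) : R :=
  \big[Num.min/head 0 s]_(a <- s) a.

Definition max_nz (R : realType) (n : nat) (S : seq 'cV[R[i]]_n)
    (f : 'cV[R[i]]_n -> R) : R :=
  max_seq [seq f x | x <- S & x != 0].

Definition min_nz (R : realType) (n : nat) (S : seq 'cV[R[i]]_n)
    (f : 'cV[R[i]]_n -> R) : R :=
  min_seq [seq f x | x <- S & x != 0].

Definition test_vectors (R : realType) (m n : nat) (A : 'M[R[i]]_(m, n))
    (v : 'cV[R[i]]_n) : seq 'cV[R[i]]_n :=
  v :: [seq rowvec A i | i <- enum 'I_m].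

(* The exponents (q - 2) / (2 (q - 1)), 1 / (q - 1) and (2 - p) / (2 p), read
   as their limits at +oo. *)
Definition row_exponent (R : realType) (q : \bar R) : R :=
  match q with
  | s%:E => (s - 2) / (2 * (s - 1))
  | +oo%E => 2^-1
  | -oo%E => 0
  end.

Definition sv_exponent (R : realType) (q : \bar R) : R :=
  match q with
  | s%:E => (s - 1)^-1
  | +oo%E => 0
  | -oo%E => 0
  end.

Definition dim_exponent (R : realType) (p : \bar R) : R :=
  match p with
  | s%:E => (2 - s) / (2 * s)
  | +oo%E => - 2^-1
  | -oo%E => 0
  end.

Definition base_factor (R : realType) (m n : nat) (A : 'M[R[i]]_(m, n))
    (j : 'I_m) (v : 'cV[R[i]]_n) (p q : \bar R) : R :=
  (lpnorm q (A *m rowvec A j) / (2 * lpnorm +oo (A *m rowvec A j)))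
      `^ row_exponent q
  * (lpnorm q (A *m v) / lpnorm 2%:E (A *m v)) `^ sv_exponent q
  * min_nz (test_vectors A v) (fun x => lpnorm 2%:E x / lpnorm p x).

(* Main.v *)
Require Import Defs.
From mathcomp Require Import all_boot all_order all_algebra.
From mathcomp Require Import spectral.
From mathcomp Require Import complex.
From mathcomp Require Import all_classical all_reals all_analysis.
From mathcomp Require Import ring lra.

Set Implicit Arguments.
Unset Strict Implicit.
Unset Printing Implicit Defensive.

Import Order.TTheory GRing.Theory Num.Theory.

Local Open Scope ring_scope.
Local Open Scope sesquilinear_scope.
Local Open Scope complex_scope.

(** No complex interpolation is needed, only Hoelder's inequality for sums and
    norming functionals. Let [w] norm [A x] in [l_q] and put [z = A^* w], so that
    [|A x|_q = |<z, x>|]. Then [|z|_2^2 = <w, A z> <= |A z|_q], where [|A z|_q]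
    is bounded by the log-convexity of [l_q] norms between [l_2], controlled by
    the top singular value, and [l_oo], whose entries are [<r_i, z>], the
    conjugates of [<w, A r_i>]. This bounds [|z|_2], hence [|A|_{2 -> q}], by
    the gains of [v] and of the rows. For [p >= 2] compare [|x|_2] with
    [|x|_p]; for [p <= 2] bound the conjugate norm [|z|_p'] between [|z|_oo],
    which is at most [|A|_{1 -> q}], and [|z|_2]. *)

Local Notation normc := Normc.normc.

(** * The complex modulus, Hoelder's inequality and a power-sum estimate *)

Lemma normc_ge0 (R : realType) (z : R[i]) : 0 <= normc z.
Proof. by case: z => a b; rewrite /= sqrtr_ge0. Qed.

Lemma conjC_conjc (R : realType) (z : R[i]) : Num.conj z = z^*%C.
Proof. by []. Qed.

Lemma normc_conjC (R : realType) (z : R[i]) : normc (Num.conj z) = normc z.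
Proof. by case: z => a b; rewrite conjC_conjc /= sqrrN. Qed.

Lemma normc_real (R : realType) (a : R) : 0 <= a -> normc a%:C = a.
Proof. by move=> a0; rewrite /= expr0n addr0 sqrtr_sqr ger0_norm. Qed.

Lemma mul_conjC_normc (R : realType) (z : R[i]) :
  Num.conj z * z = ((normc z) ^+ 2)%:C.
Proof. by rewrite rmorphXn mulrC -normCK. Qed.

Lemma normc_sum (R : realType) (I : Type) (r : seq I) (F : I -> R[i]) :
  normc (\sum_(i <- r) F i) <= \sum_(i <- r) normc (F i).
Proof.
elim/big_ind2 : _ => [|x a y b xa yb|//]; first by rewrite Normc.normc0.
exact: le_trans (le_normcD a b) (lerD xa yb).
Qed.

(** Divide [f] and [g] by the two factors on the right; Young's inequality [conjugate_powR] applied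
    termwise then sums to [p^-1 + q^-1 = 1]. *)
Lemma hoelder_sum (R : realType) (I : Type) (r : seq I) (f g : I -> R) (p q : R) :
  (forall i, 0 <= f i) -> (forall i, 0 <= g i) ->
  0 < p -> 0 < q -> p^-1 + q^-1 = 1 ->
  \sum_(i <- r) f i * g i <=
    (\sum_(i <- r) f i `^ p) `^ p^-1 * (\sum_(i <- r) g i `^ q) `^ q^-1.
Proof.
move=> f0 g0 p0 q0 pq.
(* A vanishing power sum forces every [h i] on the list to vanish, hence also the left side. This
   settles the two cases in which the normalisation would divide by zero. *)
have zero h s : (forall i, 0 <= h i) -> 0 < s ->
    \sum_(i <- r) h i `^ s = 0 -> forall k : I -> R, \sum_(i <- r) h i * k i = 0.
  move=> h0 s0 + k; elim: r => [|i t IH]; first by rewrite !big_nil.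
  rewrite !big_cons => /eqP.
  rewrite paddr_eq0 ?powR_ge0 ?sumr_ge0// => [|? _]; last exact: powR_ge0.
  move=> /andP[/eqP/powR_eq0_eq0 -> /eqP/IH ->].
  by rewrite mul0r addr0.
set F := \sum_(i <- r) f i `^ p; set G := \sum_(i <- r) g i `^ q.
have F0 : 0 <= F by rewrite sumr_ge0// => ? _; exact: powR_ge0.
have G0 : 0 <= G by rewrite sumr_ge0// => ? _; exact: powR_ge0.
have [/(zero f p f0 p0) ->|Fn0] := eqVneq F 0.
  by rewrite mulr_ge0// powR_ge0.
have [/(zero g q g0 q0) /(_ f)|Gn0] := eqVneq G 0.
  under eq_bigr do rewrite mulrC.
  by move=> ->; rewrite mulr_ge0// powR_ge0.
have Fp : 0 < F by rewrite lt_neqAle eq_sym Fn0.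
have Gp : 0 < G by rewrite lt_neqAle eq_sym Gn0.
move aE : (F `^ p^-1) => a; move bE : (G `^ q^-1) => b.
have a0 : 0 < a by rewrite -aE; exact: powR_gt0.
have b0 : 0 < b by rewrite -bE; exact: powR_gt0.
have aF : a `^ p = F by rewrite -aE -powRrM mulVf ?gt_eqF// powRr1.
have bG : b `^ q = G by rewrite -bE -powRrM mulVf ?gt_eqF// powRr1.
have ab0 := mulr_gt0 a0 b0.
rewrite -[leRHS]mulr1 -(ler_pdivrMl _ _ ab0) mulr_sumr.
apply: (@le_trans _ _ (\sum_(i <- r) (f i `^ p / F / p + g i `^ q / G / q))).
  apply: ler_sum => i _; rewrite mulrC -mulf_div.
  have fa : 0 <= f i / a by rewrite divr_ge0 ?(ltW a0).
  have gb : 0 <= g i / b by rewrite divr_ge0 ?(ltW b0).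
  apply: le_trans (conjugate_powR fa gb p0 q0 pq) _.
  have aV : 0 <= a^-1 by rewrite invr_ge0 ltW.
  have bV : 0 <= b^-1 by rewrite invr_ge0 ltW.
  rewrite (powRM _ (f0 i) aV) (powRM _ (g0 i) bV).
  rewrite -(powR_inv1 (ltW a0)) -(powR_inv1 (ltW b0)).
  by rewrite -!powRrM !mulN1r !powRN aF bG.
by rewrite big_split/= -!mulr_suml -/F -/G !divff// !mul1r pq.
Qed.

Lemma sum_powR_le (R : realType) (I : Type) (r : seq I) (f : I -> R) (T q : R) :
  (forall i, 0 <= f i <= T) -> 2 <= q ->
  \sum_(i <- r) f i `^ q <= T `^ (q - 2) * \sum_(i <- r) f i `^ 2.
Proof.
move=> fT q2; rewrite mulr_sumr; apply: ler_sum => i _.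
have /andP[fi0 fiT] := fT i.
have -> : f i `^ q = f i `^ (q - 2) * f i `^ 2.
  rewrite -powRD; first by rewrite subrK.
  by rewrite subrK (_ : q == 0 = false)//; apply/negbTE; lra.
apply: ler_wpM2r; first exact: powR_ge0.
have T0 := le_trans fi0 fiT.
by apply: ge0_ler_powR => //; lra.
Qed.

(** * Basic properties of [lpnorm], and interpolation between exponents 2 and infinity *)

Lemma lpnorm_ge0 (R : realType) (n : nat) (p : \bar R) (x : 'cV[R[i]]_n) :
  0 <= lpnorm p x.
Proof.
case: p => [s| |] //=; first exact: powR_ge0.
by elim/big_ind : _ => // [a b a0 b0|i _]; rewrite ?le_max ?a0 ?normc_ge0.
Qed.

Lemma le_lpnormoo (R : realType) (n : nat) (x : 'cV[R[i]]_n) (i : 'I_n) :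
  normc (x i ord0) <= lpnorm +oo x.
Proof. by rewrite /= (bigD1 i)//= le_max lexx. Qed.

Lemma lpnormoo_le (R : realType) (n : nat) (x : 'cV[R[i]]_n) (T : R) :
  0 <= T -> (forall i, normc (x i ord0) <= T) -> lpnorm +oo x <= T.
Proof.
move=> T0 xT /=; elim/big_ind : _ => // a b aT bT.
by rewrite ge_max aT.
Qed.

Lemma lpnorm0 (R : realType) (n : nat) (p : \bar R) :
  (1%:E <= p)%E -> lpnorm p (0 : 'cV[R[i]]_n) = 0.
Proof.
case: p => [s| |] //= s1; last first.
  apply: big1_idem => [|i _]; last by rewrite mxE Normc.normc0.
  by rewrite /= maxxx.
have s0 : s != 0 by rewrite gt_eqF// (lt_le_trans ltr01)// -lee_fin.
rewrite big1 ?powR0 ?invr_eq0// => i _.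
by rewrite mxE Normc.normc0 powR0.
Qed.

Lemma lpnorm_gt0 (R : realType) (n : nat) (p : \bar R) (x : 'cV[R[i]]_n) :
  (1%:E <= p)%E -> x != 0 -> 0 < lpnorm p x.
Proof.
move=> p1 /cV0Pn[i xi].
have ci : 0 < normc (x i ord0).
  rewrite lt_neqAle normc_ge0 andbT eq_sym.
  by apply: contra xi => /eqP/Normc.eq0_normc ->.
case: p p1 => [s| |] // s1; last exact: lt_le_trans (le_lpnormoo x i).
apply: powR_gt0; rewrite (bigD1 i)//= ltr_pwDl ?powR_gt0//.
by apply: sumr_ge0 => k _; exact: powR_ge0.
Qed.

Lemma lpnorm_powR (R : realType) (n : nat) (s : R) (x : 'cV[R[i]]_n) :
  s != 0 -> lpnorm s%:E x `^ s = \sum_(i < n) normc (x i ord0) `^ s.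
Proof.
move=> s0; rewrite /= -powRrM mulVf// powRr1//.
by apply: sumr_ge0 => k _; exact: powR_ge0.
Qed.

Lemma lpnorm2_sqr (R : realType) (n : nat) (x : 'cV[R[i]]_n) :
  lpnorm 2%:E x ^+ 2 = \sum_(i < n) normc (x i ord0) ^+ 2.
Proof.
rewrite -powR_mulrn ?lpnorm_ge0// lpnorm_powR//.
by apply: eq_bigr => i _; rewrite powR_mulrn ?normc_ge0.
Qed.

(** Log-convexity of the norms in the exponent, with a bound [T] on the entries in place of the
    maximum norm: take the [q]-th root of [sum_powR_le]. *)
Lemma lpnorm_le_interp (R : realType) (n : nat) (x : 'cV[R[i]]_n) (T q : R) :
  (forall i, normc (x i ord0) <= T) -> 2 <= q -> 0 <= T ->
  lpnorm q%:E x <= T `^ (1 - 2 / q) * lpnorm 2%:E x `^ (2 / q).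
Proof.
move=> xT q2 T0.
have q0 : q != 0 by lra.
have h : \sum_(i < n) normc (x i ord0) `^ q <=
    T `^ (q - 2) * \sum_(i < n) normc (x i ord0) `^ 2.
  by apply: sum_powR_le => // i; rewrite normc_ge0 xT.
rewrite -(@lpnorm_powR _ _ 2) in h; last by [].
have qV : 0 <= q^-1 by rewrite invr_ge0; lra.
rewrite [leLHS]/=.
have -> : 1 - 2 / q = (q - 2) / q by field.
rewrite !(powRrM _ _ q^-1) -powRM ?powR_ge0//.
apply: (ge0_ler_powR qV _ _ h); rewrite nnegrE.
  by apply: sumr_ge0 => k _; exact: powR_ge0.
by rewrite mulr_ge0 ?powR_ge0.
Qed.

(** * The Hermitian product, adjoints and norming functionals *)

Definition dotc (R : realType) (n : nat) (w z : 'cV[R[i]]_n) : R[i] :=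
  (w^t* *m z) ord0 ord0.

Lemma dotcE (R : realType) (n : nat) (w z : 'cV[R[i]]_n) :
  dotc w z = \sum_i Num.conj (w i ord0) * z i ord0.
Proof. by rewrite /dotc mxE; apply: eq_bigr => i _; rewrite !mxE. Qed.

Lemma normc_dotcC (R : realType) (n : nat) (w z : 'cV[R[i]]_n) :
  normc (dotc w z) = normc (dotc z w).
Proof.
rewrite -[RHS]normc_conjC !dotcE rmorph_sum; congr normc.
by apply: eq_bigr => i _; rewrite rmorphM/= conjCK mulrC.
Qed.

Lemma dotc_mulmx (R : realType) (m n : nat) (A : 'M[R[i]]_(m, n))
    (w : 'cV[R[i]]_m) (x : 'cV[R[i]]_n) :
  dotc w (A *m x) = dotc (A^t* *m w) x.
Proof. by rewrite /dotc trmx_mul map_mxM trmxCK mulmxA. Qed.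

Lemma dotc_rowvec (R : realType) (m n : nat) (A : 'M[R[i]]_(m, n))
    (x : 'cV[R[i]]_n) (i : 'I_m) :
  dotc (rowvec A i) x = (A *m x) i ord0.
Proof. by rewrite /dotc /rowvec trmxCK -row_mul mxE. Qed.

Lemma dotc_delta (R : realType) (n : nat) (w : 'cV[R[i]]_n) (i : 'I_n) :
  dotc w (delta_mx i ord0) = Num.conj (w i ord0).
Proof. by rewrite /dotc -colE !mxE. Qed.

Lemma normc_dotc_le (R : realType) (n : nat) (w z : 'cV[R[i]]_n) :
  normc (dotc w z) <= \sum_i normc (w i ord0) * normc (z i ord0).
Proof.
rewrite dotcE; apply: le_trans (normc_sum _ _) _.
by apply: ler_sum => i _; rewrite Normc.normcM normc_conjC.
Qed.

Lemma dotc_hoelder (R : realType) (n : nat) (p q : R) (w z : 'cV[R[i]]_n) :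
  0 < p -> 0 < q -> p^-1 + q^-1 = 1 ->
  normc (dotc w z) <= lpnorm p%:E w * lpnorm q%:E z.
Proof.
move=> p0 q0 pq; apply: le_trans (normc_dotc_le w z) _.
by apply: hoelder_sum => // i; exact: normc_ge0.
Qed.

Lemma dotc_cauchy_schwarz (R : realType) (n : nat) (w z : 'cV[R[i]]_n) :
  normc (dotc w z) <= lpnorm 2%:E w * lpnorm 2%:E z.
Proof. by apply: dotc_hoelder => //; lra. Qed.

Lemma dotc_self (R : realType) (n : nat) (z : 'cV[R[i]]_n) :
  dotc z z = (lpnorm 2%:E z ^+ 2)%:C.
Proof.
rewrite dotcE lpnorm2_sqr rmorph_sum; apply: eq_bigr => i _.
exact: mul_conjC_normc.
Qed.

Lemma lpnorm2_sqr_dotc (R : realType) (n : nat) (z : 'cV[R[i]]_n) :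
  lpnorm 2%:E z ^+ 2 = complex.Re (dotc z z).
Proof. by rewrite dotc_self. Qed.

Lemma dotc_gram (R : realType) (m n : nat) (A : 'M[R[i]]_(m, n))
    (x : 'cV[R[i]]_n) :
  dotc (A *m x) (A *m x) = dotc x (A^t* *m (A *m x)).
Proof. by rewrite [RHS]dotc_mulmx trmxCK. Qed.

(** An explicit form of [l_q] duality: [w] is a vector of conjugate norm at most 1 that attains
    equality in Hoelder's inequality against [u]. Strict [1 < q] keeps the conjugate exponent
    finite. *)
Lemma exists_norming (R : realType) (n : nat) (q : \bar R) (u : 'cV[R[i]]_n) :
  (1%:E < q)%E ->
  exists2 w, normc (dotc w u) = lpnorm q u &
    forall z, normc (dotc w z) <= lpnorm q z.
Proof.
move=> q1; have [->|u0] := eqVneq u 0.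
  exists 0 => [|z].
    by rewrite /dotc mulmx0 mxE Normc.normc0 lpnorm0 ?ltW.
  by rewrite /dotc trmx0 map_mx0 mul0mx mxE Normc.normc0 lpnorm_ge0.
case: q q1 => [q| |] //; last first.
  move=> _; have /cV0Pn[i0 _] := u0.
  (* For infinite [q] the norming vector is the basis vector at an entry of largest modulus. *)
  have [i ui] : exists i, lpnorm +oo u = normc (u i ord0).
    have [i _ hi] := @eq_bigmax _ _ _ 0 i0 xpredT
      (fun i => normc (u i ord0)) isT (fun i _ => normc_ge0 _).
    by exists i; rewrite /= hi.
  exists (delta_mx i ord0) => [|z]; rewrite normc_dotcC dotc_delta normc_conjC//.
  exact: le_lpnormoo.
rewrite lte_fin => q1.
have q0 : q != 0 by lra.
have := lpnorm_powR u q0.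
have : 0 < lpnorm q%:E u by rewrite lpnorm_gt0// lee_fin ltW.
move: (lpnorm q%:E u) => N N0 Nq.
have qq0 : q - 1 != 0 by lra.
have Nq0 : 0 < N `^ (q - 1) by exact: powR_gt0.
(* The equality case of Hoelder: [w] has the phases of [u] and moduli proportional to the power
   [q - 1] of those of [u]. Where [u i] vanishes so does [w i], whatever the value of the power
   [q - 2] of 0. *)
pose w : 'cV[R[i]]_n :=
  \col_i ((normc (u i ord0) `^ (q - 2) / N `^ (q - 1))%:C * u i ord0).
have nw i : normc (w i ord0) = normc (u i ord0) `^ (q - 1) / N `^ (q - 1).
  rewrite mxE Normc.normcM normc_real; last by rewrite divr_ge0 ?powR_ge0.
  rewrite mulrAC -{2}(powRr1 (normc_ge0 (u i ord0))) -powRD.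
    by congr (_ `^ _ / _); lra.
  by rewrite (_ : q - 2 + 1 = q - 1) ?(negbTE qq0)//; lra.
exists w => [|z].
  have -> : dotc w u = N%:C.
    transitivity ((N `^ q / N `^ (q - 1))%:C); last first.
      rewrite -powRB; last by rewrite (gt_eqF N0) implybT.
      by rewrite opprB addrC subrK powRr1 ?ltW.
    rewrite Nq mulr_suml rmorph_sum dotcE.
    apply: eq_bigr => i _; rewrite mxE rmorphM/= -mulrA mul_conjC_normc.
    rewrite conjC_conjc conjc_real -rmorphM/=; congr (_ %:C).
    rewrite mulrAC -powR_mulrn ?normc_ge0// -powRD ?subrK//.
    by rewrite (negbTE q0).
  by rewrite normc_real// ltW.
(* Since [(q - 1) * q' = q], the [q']-th powers of the moduli of [w] sum to [N^q / N^q = 1]. *)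
pose q' := q / (q - 1).
have q'0 : 0 < q' by rewrite divr_gt0; lra.
have qgt0 : 0 < q by lra.
have qq' : q'^-1 + q^-1 = 1.
  by rewrite invf_div -[X in _ + X]mul1r -mulrDl subrK divff.
apply: le_trans (dotc_hoelder w z q'0 qgt0 qq') _.
suff -> : lpnorm q'%:E w = 1 by rewrite mul1r lexx.
rewrite /=.
under eq_bigr => i _.
  rewrite nw -powRN powRM ?powR_ge0// -!powRrM mulNr.
  rewrite (_ : (q - 1) * q' = q); last by rewrite /q' mulrC divfK.
  over.
rewrite -mulr_suml -Nq powRN divff ?powR1//.
by rewrite gt_eqF// powR_gt0.
Qed.

(** * The largest singular value as the Euclidean operator norm *)

Lemma exists_gram_eigenvalue (R : realType) (m n : nat) (A : 'M[R[i]]_(m, n))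
    (s : R) (e : 'cV[R[i]]_n) (d : R[i]) :
  (forall t, singular_value A t -> t <= s) -> 0 <= s ->
  e != 0 -> A^t* *m (A *m e) = d *: e ->
  exists2 t : R, 0 <= t <= s & d = (t ^+ 2)%:C.
Proof.
move=> smax s0 e0 He.
have ne : 0 < lpnorm 2%:E e by rewrite lpnorm_gt0// lee_fin ler1n.
have dE : (lpnorm 2%:E (A *m e) ^+ 2)%:C = d * (lpnorm 2%:E e ^+ 2)%:C.
  rewrite -!dotc_self dotc_gram He.
  by rewrite /dotc -scalemxAr mxE.
(* Pairing the eigenvalue equation with [e] gives [|A e|^2 = d |e|^2], so [d] is the square of this
   [t]. If [t] is nonzero, [A e / t] and [e] form a singular pair, whence [t <= s]; if [t = 0], the
   bound is [0 <= s]. *)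
pose t := lpnorm 2%:E (A *m e) / lpnorm 2%:E e.
have dt : d = (t ^+ 2)%:C.
  have ne2 : (lpnorm 2%:E e ^+ 2)%:C != 0 :> R[i].
    by rewrite fmorph_eq0 expf_eq0/= gt_eqF.
  apply: (mulIf ne2); rewrite -dE -rmorphM/= /t -exprMn divfK//.
  by rewrite gt_eqF.
have t0 : 0 <= t by rewrite divr_ge0 ?lpnorm_ge0.
exists t => //; rewrite t0/=.
have [->//|tn0] := eqVneq t 0.
have tC : t%:C != 0 :> R[i] by rewrite fmorph_eq0.
apply: smax; exists (t%:C^-1 *: (A *m e)), e; split => //.
- rewrite scaler_eq0 invr_eq0 negb_or tC/=.
  apply: contra tn0 => /eqP Ae0; rewrite /t Ae0 lpnorm0 ?mul0r//.
  by rewrite lee_fin ler1n.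
- by rewrite scalerA divff// scale1r.
- rewrite -scalemxAr He dt scalerA rmorphXn/= expr2 mulrA mulVf//.
  by rewrite mul1r.
Qed.

(** The Gram matrix is Hermitian, hence normal, so the spectral theorem applies. *)
Lemma gram_unitary_diag (R : realType) (m n : nat) (A : 'M[R[i]]_(m, n)) :
  exists (P : 'M[R[i]]_n) (D : 'rV[R[i]]_n),
    P *m P^t* = 1%:M /\ A^t* *m A = P^t* *m diag_mx D *m P.
Proof.
set H := A^t* *m A.
have /orthomx_spectralP HE : H \is normalmx.
  by apply/normalmxP; rewrite /H trmx_mul map_mxM trmxCK.
have Pu : spectralmx H \is unitarymx by exact: spectral_unitarymx.
exists (spectralmx H), (spectral_diag H); split; first exact/unitarymxP.
by rewrite {1}HE (invmx_unitary Pu).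
Qed.

Lemma lpnorm2_isometry (R : realType) (m n : nat) (P : 'M[R[i]]_(m, n))
    (x : 'cV[R[i]]_n) :
  P^t* *m P = 1%:M -> lpnorm 2%:E (P *m x) = lpnorm 2%:E x.
Proof.
move=> PP; apply/eqP; rewrite -(@eqrXn2 _ 2) ?lpnorm_ge0//.
rewrite (lpnorm2_sqr_dotc x).
rewrite (lpnorm2_sqr_dotc (P *m x)).
by rewrite dotc_gram mulmxA PP mul1mx.
Qed.

(** In an orthonormal eigenbasis of the Gram matrix, [|A x|^2] is the sum of the squared coordinates
    of [x] weighted by eigenvalues, each of which is the square of some [t <= s]. *)
Lemma lpnorm2_mulmx_le (R : realType) (m n : nat) (A : 'M[R[i]]_(m, n))
    (s : R) (x : 'cV[R[i]]_n) :
  (forall t, singular_value A t -> t <= s) -> 0 <= s ->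
  lpnorm 2%:E (A *m x) <= s * lpnorm 2%:E x.
Proof.
move=> smax s0; pose H := A^t* *m A.
have [P [D [PP HE]]] := gram_unitary_diag A; rewrite -/H in HE.
have PP' := mulmx1C PP.
(* The columns of [P^t*] are the eigenvectors. *)
have eig k : exists2 t : R, 0 <= t <= s & D ord0 k = (t ^+ 2)%:C.
  apply: (@exists_gram_eigenvalue _ _ _ A s (P^t* *m delta_mx k ord0)) => //.
    apply/eqP => /(congr1 (mulmx P)); rewrite mulmxA PP mul1mx mulmx0.
    by move=> /matrixP/(_ k ord0)/eqP; rewrite !mxE !eqxx oner_eq0.
  rewrite mulmxA -/H HE -!mulmxA (mulmxA P) PP mul1mx scalemxAr; congr (_ *m _).
  apply/matrixP => i l; rewrite mul_diag_mx !mxE.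
  by case: eqVneq => [->|_] //=; rewrite !mulr0.
have Hx : dotc (A *m x) (A *m x) = dotc (P *m x) (diag_mx D *m (P *m x)).
  rewrite dotc_gram (mulmxA (A^t*)) -/H HE.
  by rewrite -!mulmxA [LHS]dotc_mulmx trmxCK.
have Px := lpnorm2_isometry x PP'.
have h : lpnorm 2%:E (A *m x) ^+ 2 <= s ^+ 2 * lpnorm 2%:E (P *m x) ^+ 2.
  rewrite -lecR -dotc_self Hx dotcE lpnorm2_sqr mulr_sumr rmorph_sum/=.
  apply: ler_sum => k _.
  rewrite mul_diag_mx [X in _ * X]mxE; have [t /andP[t0 ts] ->] := eig k.
  rewrite mulrCA mul_conjC_normc -rmorphM/= lecR.
  apply: ler_wpM2r; first exact: sqr_ge0.
  by rewrite ler_pXn2r ?nnegrE// (le_trans t0).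
rewrite Px -exprMn in h.
by rewrite -(@ler_pXn2r _ 2 isT) ?nnegrE ?mulr_ge0 ?lpnorm_ge0.
Qed.

(** From [|A v|^2 = <v, A^* A v> = s^2 |v|^2]; no normalisation of [u] or [v] enters. *)
Lemma singular_triple_gain (R : realType) (m n : nat) (A : 'M[R[i]]_(m, n))
    (s : R) (u : 'cV[R[i]]_m) (v : 'cV[R[i]]_n) :
  singular_triple A s u v -> lpnorm 2%:E (A *m v) = s * lpnorm 2%:E v.
Proof.
move=> [s0 _ _ Av Au].
apply/eqP; rewrite -(@eqrXn2 _ 2) ?mulr_ge0 ?lpnorm_ge0//; apply/eqP.
rewrite exprMn lpnorm2_sqr_dotc dotc_gram Av -scalemxAr Au scalerA.
by rewrite /dotc -scalemxAr mxE -/(dotc v v) dotc_self -!rmorphM /= expr2.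
Qed.

(** * Extrema over the nonzero test vectors *)

Lemma le_max_nz (R : realType) (n : nat) (S : seq 'cV[R[i]]_n)
    (f : 'cV[R[i]]_n -> R) (x : 'cV[R[i]]_n) :
  x \in S -> x != 0 -> f x <= max_nz S f.
Proof.
move=> xS x0; rewrite /max_nz /max_seq.
apply: (@le_bigmax_seq _ _ _ _ _ (f x) xpredT id) => //.
by apply: map_f; rewrite mem_filter x0.
Qed.

Lemma min_nz_le (R : realType) (n : nat) (S : seq 'cV[R[i]]_n)
    (f : 'cV[R[i]]_n -> R) (x : 'cV[R[i]]_n) :
  x \in S -> x != 0 -> min_nz S f <= f x.
Proof.
move=> xS x0; rewrite /min_nz /min_seq.
apply: (@ge_bigmin_seq _ _ _ _ _ (f x) xpredT id) => //.
by apply: map_f; rewrite mem_filter x0.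
Qed.

Lemma min_nz_gt0 (R : realType) (n : nat) (S : seq 'cV[R[i]]_n)
    (f : 'cV[R[i]]_n -> R) (x : 'cV[R[i]]_n) :
  x \in S -> x != 0 -> (forall y, y != 0 -> 0 < f y) -> 0 < min_nz S f.
Proof.
move=> xS x0 f0; rewrite /min_nz /min_seq big_seq.
have pos a : a \in [seq f y | y <- S & y != 0] -> 0 < a.
  by move=> /mapP[y]; rewrite mem_filter => /andP[y0 _] ->; exact: f0.
have : f x \in [seq f y | y <- S & y != 0].
  by apply: map_f; rewrite mem_filter x0.
(* The list is nonempty thanks to [x], so the starting value [head 0] of the minimum is one of its
   positive entries and not the default 0. *)
case: [seq f y | y <- S & y != 0] pos => // a t pos _ /=.
elim/big_ind : _ => [|b c b0 c0|b]; last exact: pos.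
  by apply: pos; rewrite mem_head.
by rewrite lt_min b0.
Qed.

Lemma gain_ge0 (R : realType) (m n : nat) (A : 'M[R[i]]_(m, n)) (p q : \bar R)
    (x : 'cV[R[i]]_n) : 0 <= gain A p q x.
Proof. by rewrite divr_ge0 ?lpnorm_ge0. Qed.

(** * Bounding [A^* w] by the gains of the test vectors *)

Lemma lpnorm_rowvec_gt0 (R : realType) (m n : nat) (A : 'M[R[i]]_(m, n))
    (j : 'I_m) : A != 0 ->
  (forall i, lpnorm 2%:E (rowvec A i) <= lpnorm 2%:E (rowvec A j)) ->
  0 < lpnorm 2%:E (rowvec A j).
Proof.
move=> A0 hj.
have /matrix0Pn[i [k Aik]] := A0.
apply: lt_le_trans (hj i); apply: lpnorm_gt0; first by rewrite lee_fin ler1n.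
by apply/cV0Pn; exists k; rewrite !mxE conjC_eq0.
Qed.

(** The entries of [A r_j] are the products [<r_i, r_j>]: Cauchy-Schwarz and the maximality of [r_j]
    bound them by [|r_j|^2], which is attained at [i = j]. *)
Lemma lpnormoo_mulmx_rowvec (R : realType) (m n : nat) (A : 'M[R[i]]_(m, n))
    (j : 'I_m) :
  (forall i, lpnorm 2%:E (rowvec A i) <= lpnorm 2%:E (rowvec A j)) ->
  lpnorm +oo (A *m rowvec A j) = lpnorm 2%:E (rowvec A j) ^+ 2.
Proof.
move=> hj; apply/eqP; rewrite eq_le; apply/andP; split.
  apply: lpnormoo_le => [|i]; first exact: sqr_ge0.
  rewrite -dotc_rowvec; apply: le_trans (dotc_cauchy_schwarz _ _) _.
  by rewrite expr2 ler_wpM2r// lpnorm_ge0.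
apply: le_trans (le_lpnormoo _ j).
by rewrite -dotc_rowvec dotc_self normc_real ?sqr_ge0.
Qed.

Lemma exponents_ge0 (R : realType) (q : \bar R) : (2%:E <= q)%E ->
  [/\ 0 <= row_exponent q, 0 <= sv_exponent q
    & row_exponent q *+ 2 + sv_exponent q = 1].
Proof.
case: q => [q| |] //=; last by move=> _; split; lra.
rewrite lee_fin => q2.
have q1 : q - 1 != 0 by lra.
by split; [rewrite divr_ge0//; lra|rewrite invr_ge0; lra|field].
Qed.

(** The unknown [z] occurs on both sides: move [z^(2/q)] to the left and take the root of order
    [2 - 2/q]. This is where the exponents of [base_factor] come from. *)
Lemma le_of_sqr_le_interp (R : realType) (q T s z : R) :
  2 <= q -> 0 <= T -> 0 <= s -> 0 <= z ->
  z ^+ 2 <= T `^ (1 - 2 / q) * (s * z) `^ (2 / q) ->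
  z <= T `^ row_exponent q%:E * s `^ sv_exponent q%:E.
Proof.
move=> q2 T0 s0 z0 /=; move: z0; rewrite le_eqVlt => /predU1P[<- _|z0 h].
  by rewrite mulr_ge0 ?powR_ge0.
have q0 : q != 0 by lra.
have q10 : q - 1 != 0 by lra.
have zq0 : 0 < z `^ (2 / q) by exact: powR_gt0.
have {}h : z `^ (2 - 2 / q) <= T `^ (1 - 2 / q) * s `^ (2 / q).
  rewrite powRB; last by rewrite (gt_eqF z0) implybT.
  rewrite ler_pdivrMr// -mulrA -powRM// ?(ltW z0)//.
  by rewrite powR_mulrn ?(ltW z0).
(* The inverse of [2 - 2 / q]. *)
pose k := q / (2 * (q - 1)).
have k0 : 0 <= k by rewrite divr_ge0; lra.
have -> : z = (z `^ (2 - 2 / q)) `^ k.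
  rewrite -powRrM (_ : _ * k = 1) ?powRr1 ?(ltW z0)//.
  by rewrite /k; field; apply/andP.
have -> : (q - 2) / (2 * (q - 1)) = (1 - 2 / q) * k.
  by rewrite /k; field; apply/andP.
have -> : (q - 1)^-1 = 2 / q * k.
  by rewrite /k; field; apply/andP.
rewrite (powRrM T) (powRrM s) -powRM ?powR_ge0//.
by apply: (ge0_ler_powR k0 _ _ h); rewrite nnegrE ?mulr_ge0 ?powR_ge0.
Qed.

Lemma lpnorm2_adjoint_le (R : realType) (m n : nat) (A : 'M[R[i]]_(m, n))
    (s T : R) (q : \bar R) (w : 'cV[R[i]]_m) :
  (2%:E <= q)%E -> 0 <= s -> 0 <= T ->
  (forall x, lpnorm 2%:E (A *m x) <= s * lpnorm 2%:E x) ->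
  (forall i, lpnorm q (A *m rowvec A i) <= T) ->
  (forall z, normc (dotc w z) <= lpnorm q z) ->
  lpnorm 2%:E (A^t* *m w) <= T `^ row_exponent q * s `^ sv_exponent q.
Proof.
move=> q2 s0 T0 As AT wq; set z := A^t* *m w.
have z2 : lpnorm 2%:E z ^+ 2 <= lpnorm q (A *m z).
  apply: le_trans (wq (A *m z)).
  by rewrite dotc_mulmx -/z dotc_self normc_real ?sqr_ge0.
have zT i : normc ((A *m z) i ord0) <= T.
  rewrite -dotc_rowvec normc_dotcC -dotc_mulmx.
  exact: le_trans (wq _) (AT i).
case: q q2 AT wq z2 => [q| |] //.
  rewrite lee_fin => q2 _ _ z2; apply: le_of_sqr_le_interp => //.
    exact: lpnorm_ge0.
  apply: le_trans z2 _; apply: le_trans (lpnorm_le_interp zT q2 T0) _.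
  apply: ler_wpM2l; first exact: powR_ge0.
  apply: ge0_ler_powR; rewrite ?nnegrE ?mulr_ge0 ?lpnorm_ge0//.
  by rewrite invr_ge0; lra.
(* At infinite [q] the exponents are 1/2 and 0, and [|z|^2 <= |A z|_oo <= T] needs only a square
   root. *)
move=> _ _ _ z2; rewrite [leRHS]/= powRr0 mulr1 powR12_sqrt//.
rewrite -(ger0_norm (lpnorm_ge0 2%:E z)) -sqrtr_sqr ler_wsqrtr//.
by apply: le_trans z2 _; exact: lpnormoo_le.
Qed.

(** Pair [a] with [K r] and [b] with [s]: the products are at most [K^2] and [K], and the exponents
    combine to [K^(2 e1 + e2) = K]. It is used with [a], [b] the two bracketed ratios of
    [base_factor] and [r] the norm of [r_j]. *)
Lemma mul_powR_le_interp (R : realType) (a b r s z K e1 e2 : R) :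
  0 <= a -> 0 <= b -> 0 <= r -> 0 <= s -> 0 <= K -> 0 <= e1 -> 0 <= e2 ->
  e1 *+ 2 + e2 = 1 -> a * r <= K -> b * s <= K ->
  z <= (K * r) `^ e1 * s `^ e2 -> a `^ e1 * b `^ e2 * z <= K.
Proof.
move=> a0 b0 r0 s0 K0 e10 e20 e12 arK bsK zle.
have ab0 : 0 <= a `^ e1 * b `^ e2 by rewrite mulr_ge0 ?powR_ge0.
apply: le_trans (ler_wpM2l ab0 zle) _.
rewrite mulrACA -!powRM ?mulr_ge0//.
apply: (@le_trans _ _ ((K `^ 2) `^ e1 * K `^ e2)).
  apply: ler_pM; rewrite ?powR_ge0//.
    apply: ge0_ler_powR; rewrite ?nnegrE ?powR_ge0 ?mulr_ge0//.
    by rewrite powR_mulrn// expr2 mulrCA ler_wpM2l.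
  by apply: ge0_ler_powR; rewrite ?nnegrE ?mulr_ge0.
rewrite -powRrM -powRD mulrC mulr_natr e12 ?powRr1//.
by rewrite oner_eq0.
Qed.

(** The bound [M] is left arbitrary so that both halves of the theorem can use it, with the maximum
    taken over the test vectors with or without [y]. *)
Lemma base_factor_adjoint_le (R : realType) (m n : nat) (A : 'M[R[i]]_(m, n))
    (j : 'I_m) (v : 'cV[R[i]]_n) (p q : \bar R) (M : R) :
  A != 0 ->
  (forall i, lpnorm 2%:E (rowvec A i) <= lpnorm 2%:E (rowvec A j)) ->
  top_right_singular_vector A v -> (1%:E <= p)%E -> (2%:E <= q)%E ->
  (forall x, x \in test_vectors A v -> x != 0 -> gain A p q x <= M) ->
  0 < base_factor A j v p q /\
  forall w, (forall z, normc (dotc w z) <= lpnorm q z) ->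
    base_factor A j v p q * lpnorm 2%:E (A^t* *m w) <= M.
Proof.
move=> A0 hj [s [[u suv] smax]] p1 q2 gM.
have [s0 _ v0 _ _] := suv.
have q1 : (1%:E <= q)%E by apply: le_trans q2; rewrite lee_fin ler1n.
have two1 : (1%:E <= 2%:E :> \bar R)%E by rewrite lee_fin ler1n.
have As x := lpnorm2_mulmx_le x smax s0.
have rho0 := lpnorm_rowvec_gt0 A0 hj.
have rhooo := lpnormoo_mulmx_rowvec hj.
have Av2 := singular_triple_gain suv.
have nv0 := lpnorm_gt0 two1 v0.
have vS : v \in test_vectors A v by rewrite mem_head.
have rS i : rowvec A i \in test_vectors A v.
  by rewrite inE map_f ?orbT// mem_enum.
(* Positivity of the denominators: [|A r_j|_oo = |r_j|^2 > 0], so [s > 0] by the Euclidean bound, so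
   [A v] is nonzero. *)
have Ar0 : A *m rowvec A j != 0.
  apply/eqP => h; have := exprn_gt0 2 rho0.
  by rewrite -rhooo h lpnorm0 ?ltxx// leey.
have sgt0 : 0 < s.
  have := lt_le_trans (lpnorm_gt0 two1 Ar0) (As (rowvec A j)).
  by rewrite (pmulr_lgt0 s rho0).
have Av0 : A *m v != 0.
  apply/eqP => h; have := mulr_gt0 sgt0 nv0.
  by rewrite -Av2 h lpnorm0 ?ltxx.
rewrite /base_factor rhooo Av2; set mn := min_nz _ _.
have mn0 : 0 < mn.
  apply: (min_nz_gt0 vS v0) => y y0.
  by apply: divr_gt0; exact: lpnorm_gt0.
(* The minimum [mn] trades the [p]-norm for the Euclidean norm: on test vectors the gain from 2 to
   [q] is at most [K = M / mn]. *)
have SM x : x \in test_vectors A v -> lpnorm q (A *m x) <= M / mn * lpnorm 2%:E x.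
  move=> xS; have [->|x0] := eqVneq x 0.
    by rewrite mulmx0 !lpnorm0// mulr0.
  have p0 := lpnorm_gt0 p1 x0; have x2 := lpnorm_gt0 two1 x0.
  have := gM x xS x0; rewrite /gain ler_pdivrMr// => /le_trans; apply.
  rewrite mulrAC ler_pdivlMr//.
  have M0 : 0 <= M := le_trans (gain_ge0 _ _ _ _) (gM v vS v0).
  have := min_nz_le (fun x => lpnorm 2%:E x / lpnorm p x) xS x0.
  rewrite -/mn (ler_pdivlMr _ _ p0) -mulrA => h.
  by apply: (ler_wpM2l M0); rewrite mulrC.
have M0 : 0 <= M / mn.
  apply: divr_ge0 (ltW mn0).
  exact: le_trans (gain_ge0 _ _ _ _) (gM v vS v0).
have T0 := mulr_ge0 M0 (ltW rho0).
have AT i : lpnorm q (A *m rowvec A i) <= M / mn * lpnorm 2%:E (rowvec A j).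
  exact: le_trans (SM _ (rS i)) (ler_wpM2l M0 (hj i)).
have [e10 e20 e12] := exponents_ge0 q2.
have al0 := lpnorm_gt0 q1 Ar0; have be0 := lpnorm_gt0 q1 Av0.
have two0 : 0 < 2 :> R := ltr0Sn R 1.
have rho2 := mulr_gt0 two0 (exprn_gt0 2 rho0).
have snv := mulr_gt0 sgt0 nv0.
have a0 := divr_gt0 al0 rho2.
have b0 := divr_gt0 be0 snv.
split=> [|w wq].
  exact: mulr_gt0 (mulr_gt0 (powR_gt0 _ a0) (powR_gt0 _ b0)) mn0.
have zle := lpnorm2_adjoint_le q2 s0 T0 As AT wq.
rewrite mulrAC -(ler_pdivlMr _ _ mn0).
apply: (mul_powR_le_interp (ltW a0) (ltW b0) (ltW rho0) s0 M0 e10 e20 e12 _ _ zle).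
  rewrite mulrAC (ler_pdivrMr _ _ rho2) expr2 mulrA mulrA.
  apply: (ler_wpM2r (ltW rho0)); apply: le_trans (AT j) _.
  by rewrite (mulrC 2) mulrA (ler_peMr T0)// ler1n.
rewrite mulrAC (ler_pdivrMr _ _ snv) mulrC mulrCA.
exact: (ler_wpM2l s0 (SM v vS)).
Qed.

(** * Comparison of norms of [x] and estimates of [<z, x>] *)

Lemma lpnorm2_le_lpnorm (R : realType) (n : nat) (p : \bar R)
    (x : 'cV[R[i]]_n) : (0 < n)%N -> (2%:E <= p)%E ->
  n%:R `^ dim_exponent p * lpnorm 2%:E x <= lpnorm p x.
Proof.
move=> n_gt0 p2; have n0 : 0 < n%:R :> R by rewrite ltr0n.
have -> : dim_exponent p = - (- dim_exponent p) by rewrite opprK.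
rewrite powRN mulrC ler_pdivrMr ?powR_gt0//.
have S0 s : 0 <= \sum_(i < n) normc (x i ord0) `^ s.
  by apply: sumr_ge0 => k _; exact: powR_ge0.
have half0 : 0 <= 2^-1 :> R by rewrite invr_ge0 ler0n.
case: p p2 => [p| |] // p2; last first.
  have L0 := lpnorm_ge0 +oo x.
  have h : \sum_(i < n) normc (x i ord0) `^ 2 <= n%:R * lpnorm +oo x `^ 2.
    have -> : n%:R * lpnorm +oo x `^ 2 = \sum_(i < n) lpnorm +oo x `^ 2.
      by rewrite sumr_const card_ord mulr_natl.
    apply: ler_sum => i _; apply: ge0_ler_powR; rewrite ?nnegrE ?normc_ge0//.
    exact: le_lpnormoo.
  have -> : lpnorm +oo x * n%:R `^ (- dim_exponent +oo) =
      (n%:R * lpnorm +oo x `^ 2) `^ 2^-1.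
    rewrite (powRM _ (ltW n0) (powR_ge0 _ _)) -powRrM.
    by rewrite (divff (lt0r_neq0 (ltr0Sn R 1))) (powRr1 L0) mulrC /= opprK.
  apply: (ge0_ler_powR half0 _ _ h); rewrite nnegrE ?S0//.
  by rewrite mulr_ge0 ?powR_ge0 ?ltW.
rewrite lee_fin in p2.
have p0 : p != 0 by lra.
(* At [p = 2] the exponent [p / (p - 2)] used below degenerates. *)
have [->|p2'] := eqVneq p 2; first by rewrite /= subrr mul0r oppr0 powRr0 mulr1.
have pgt2 : 2 < p by rewrite lt_neqAle eq_sym p2'.
have pm2 : p - 2 != 0 by lra.
(* Hoelder for the squared moduli against the constant 1, with these conjugate exponents; the
   constant contributes the power of [n]. *)
pose a := p / 2; pose b := p / (p - 2).
have a0 : 0 < a by rewrite divr_gt0; lra.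
have b0 : 0 < b by rewrite divr_gt0; lra.
have ab : a^-1 + b^-1 = 1 by rewrite /a /b; field; apply/andP.
have := @hoelder_sum R _ (index_enum 'I_n) (fun i => normc (x i ord0) `^ 2)
  (fun=> 1) a b (fun i => powR_ge0 _ _) (fun=> ler01) a0 b0 ab.
under eq_bigr do rewrite mulr1.
under [X in _ <= X `^ _ * _]eq_bigr => i _.
  rewrite -powRrM (_ : 2 * a = p); last by rewrite /a mulrC divfK.
  over.
rewrite powR1 sumr_const card_ord => h.
have := ge0_ler_powR half0 (S0 2) _ h.
rewrite nnegrE mulr_ge0 ?powR_ge0// => /(_ isT).
rewrite powRM ?powR_ge0// -!powRrM /= => /le_trans; apply.
have -> : a^-1 / 2 = p^-1 by rewrite /a; field.
have -> : b^-1 / 2 = - ((2 - p) / (2 * p)) by rewrite /b; field; apply/andP.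
exact: lexx.
Qed.

Lemma dotc_le_l1 (R : realType) (n : nat) (z x : 'cV[R[i]]_n) (N : R) :
  (forall i, normc (z i ord0) <= N) -> normc (dotc z x) <= N * lpnorm 1%:E x.
Proof.
move=> zN; apply: le_trans (normc_dotc_le z x) _.
rewrite /= invr1 powRr1; last by apply: sumr_ge0 => k _; exact: powR_ge0.
rewrite mulr_sumr; apply: ler_sum => i _.
by rewrite powRr1 ?normc_ge0//; apply: ler_wpM2r (zN i); exact: normc_ge0.
Qed.

(** Hoelder with the conjugate exponent [p' = p / (p - 1) >= 2], then interpolation of the [p']-norm
    of [z] between the bounds [N] and [C]. At [p = 1], where [p'] is infinite, only [N] remains. *)
Lemma dotc_le_interp (R : realType) (n : nat) (z x : 'cV[R[i]]_n) (p N C : R) :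
  1 <= p -> p <= 2 -> 0 <= N ->
  (forall i, normc (z i ord0) <= N) -> lpnorm 2%:E z <= C ->
  normc (dotc z x) <= N `^ ((2 - p) / p) * C `^ (2 * (p - 1) / p) * lpnorm p%:E x.
Proof.
move=> p1 p2 N0 zN zC.
move: p1; rewrite le_eqVlt => /predU1P[<-|p1].
  have -> : (2 - 1) / 1 = 1 :> R by lra.
  rewrite subrr mulr0 mul0r powRr0 mulr1 powRr1//.
  exact: dotc_le_l1.
have p0 : 0 < p by lra.
have pn0 : p != 0 by lra.
have pm1 : p - 1 != 0 by lra.
pose p' := p / (p - 1).
have p'2 : 2 <= p' by rewrite /p' ler_pdivlMr; lra.
have p'0 : 0 < p' by lra.
have pp' : p'^-1 + p^-1 = 1 by rewrite /p'; field; apply/andP.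
apply: le_trans (dotc_hoelder z x p'0 p0 pp') _.
apply: ler_wpM2r; first exact: lpnorm_ge0.
apply: le_trans (lpnorm_le_interp zN p'2 N0) _.
have -> : 1 - 2 / p' = (2 - p) / p by rewrite /p'; field; apply/andP.
have -> : 2 / p' = 2 * (p - 1) / p by rewrite /p'; field; apply/andP.
apply: ler_wpM2l; first exact: powR_ge0.
have C0 : 0 <= C := le_trans (lpnorm_ge0 _ _) zC.
apply: (ge0_ler_powR _ _ _ zC); rewrite ?nnegrE ?lpnorm_ge0//.
by rewrite divr_ge0; lra.
Qed.

Lemma lpnorm1_delta (R : realType) (n : nat) (i : 'I_n) :
  lpnorm 1%:E (delta_mx i ord0 : 'cV[R[i]]_n) = 1.
Proof.
rewrite /= (bigD1 i)//= big1 => [|k ki]; last first.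
  by rewrite mxE (negbTE ki) Normc.normc0 powR0// oner_eq0.
by rewrite mxE !eqxx Normc.normc1 !powR1 addr0 powR1.
Qed.

Lemma normc_adjoint_entry (R : realType) (m n : nat) (A : 'M[R[i]]_(m, n))
    (w : 'cV[R[i]]_m) (i : 'I_n) :
  normc ((A^t* *m w) i ord0) = normc (dotc w (A *m delta_mx i ord0)).
Proof. by rewrite dotc_mulmx dotc_delta normc_conjC. Qed.

(** The nonzero [v] witnesses that the set of gains is nonempty, as bounding a supremum from above
    requires. *)
Lemma opnorm_le (R : realType) (m n : nat) (A : 'M[R[i]]_(m, n)) (p q : \bar R)
    (v : 'cV[R[i]]_n) (C : R) :
  v != 0 -> (1%:E <= p)%E ->
  (forall x, lpnorm q (A *m x) <= C * lpnorm p x) -> opnorm A p q <= C.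
Proof.
move=> v0 p1 AC; apply: ge_sup; first by exists (gain A p q v), v.
move=> _ [x x0 <-]; rewrite /gain ler_pdivrMr; first exact: AC.
exact: lpnorm_gt0.
Qed.

Lemma gain_le_opnorm1 (R : realType) (m n : nat) (A : 'M[R[i]]_(m, n))
    (q : \bar R) (x : 'cV[R[i]]_n) :
  (1%:E < q)%E -> x != 0 -> gain A 1%:E q x <= opnorm A 1%:E q.
Proof.
move=> q1 x0; apply: ub_le_sup; last by exists x.
(* Bounded above: the sum of the column norms dominates every entry of [A^* w], hence every gain
   from the 1-norm. *)
exists (\sum_k lpnorm q (A *m delta_mx k ord0)) => _ [{x0}x x0 <-].
have x1 : 0 < lpnorm 1%:E x by exact: lpnorm_gt0.
rewrite /gain (ler_pdivrMr _ _ x1).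
have [w <- wq] := exists_norming (A *m x) q1.
rewrite dotc_mulmx; apply: dotc_le_l1 => i; rewrite normc_adjoint_entry.
apply: le_trans (wq _) _; rewrite (bigD1 i)//= lerDl.
by apply: sumr_ge0 => k _; exact: lpnorm_ge0.
Qed.

(** * The two lower bounds *)

Lemma interp_exponents (R : realType) (p : R) : 1 <= p -> p <= 2 ->
  0 <= (2 - p) / p /\ (2 - p) / p + 2 * (p - 1) / p = 1.
Proof. by move=> p1 p2; split; [rewrite divr_ge0; lra|field; lra]. Qed.

Theorem theorem3 (R : realType) (m n : nat) (A : 'M[R[i]]_(m, n))
    (hA : A != 0)
    (j : 'I_m)
    (hj : forall i : 'I_m,
        lpnorm 2%:E (rowvec A i) <= lpnorm 2%:E (rowvec A j))
    (v : 'cV[R[i]]_n)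
    (hv : top_right_singular_vector A v) :
  (forall (p : R) (q : \bar R) (y : 'cV[R[i]]_n),
      1 <= p -> p <= 2 -> (2%:E <= q)%E ->
      y != 0 -> gain A 1%:E q y = opnorm A 1%:E q ->
      max_nz (test_vectors A v ++ [:: y]) (gain A p%:E q) >=
        (lpnorm 1%:E y / lpnorm p%:E y) `^ ((2 - p) / p)
        * (base_factor A j v p%:E q) `^ (2 * (p - 1) / p)
        * opnorm A p%:E q)
  /\
  (forall p q : \bar R,
      (2%:E <= p)%E -> (2%:E <= q)%E ->
      max_nz (test_vectors A v) (gain A p q) >=
        n%:R `^ dim_exponent p * base_factor A j v p q * opnorm A p q).
Proof.
have [s [[u [_ _ v0 _ _]] _]] := hv.
have lt1 q : (2%:E <= q)%E -> (1%:E < q :> \bar R)%E.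
  by apply: lt_le_trans; rewrite lte_fin ltr1n.
split=> [p q y p1 p2 q2 y0 yq|p q p2 q2].
  have q1 := lt1 q q2; have [a0 aE] := interp_exponents p1 p2.
  have ep1 : (1%:E <= p%:E)%E by rewrite lee_fin.
  set M := max_nz _ _.
  have gM x : x \in test_vectors A v -> x != 0 -> gain A p%:E q x <= M.
    by move=> xS; apply: le_max_nz; rewrite mem_cat xS.
  have yM : gain A p%:E q y <= M.
    by apply: le_max_nz => //; rewrite mem_cat mem_head orbT.
  have M0 := le_trans (gain_ge0 _ _ _ _) yM.
  have [B0 Bw] := base_factor_adjoint_le hA hj hv ep1 q2 gM.
  have := gain_ge0 A 1%:E q y; rewrite yq => N0.
  move: (base_factor A j v p%:E q) B0 Bw => B B0 Bw.
  (* The entries of [z = A^* w] are at most the 1-to-[q] norm, since basis vectors have unit 1-norm,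
     and its Euclidean norm is at most [M / B]. *)
  have opC : opnorm A p%:E q <=
      opnorm A 1%:E q `^ ((2 - p) / p) * (M / B) `^ (2 * (p - 1) / p).
    apply: (opnorm_le v0 ep1) => x.
    have [w <- wq] := exists_norming (A *m x) q1.
    rewrite dotc_mulmx; apply: dotc_le_interp => // [i|].
      rewrite normc_adjoint_entry; apply: le_trans (wq _) _.
      have d0 : delta_mx i ord0 != 0 :> 'cV[R[i]]_n.
        by apply/cV0Pn; exists i; rewrite mxE !eqxx oner_eq0.
      have := gain_le_opnorm1 A q1 d0.
      by rewrite /gain lpnorm1_delta divr1.
    by rewrite (ler_pdivlMr _ _ B0) mulrC; exact: Bw.
  have ny1 : 0 < lpnorm 1%:E y by exact: lpnorm_gt0.
  have nyp := lpnorm_gt0 ep1 y0.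
  have Y0 := divr_ge0 (ltW ny1) (ltW nyp).
  have MB0 := divr_ge0 M0 (ltW B0).
  apply: le_trans (ler_wpM2l _ opC) _; first by rewrite mulr_ge0 ?powR_ge0.
  (* Group equal exponents: [B] cancels against [M / B], and the ratio of the norms of [y] times the
     1-to-[q] norm is the gain of [y] from [p] to [q], at most [M]. The exponents sum to 1, leaving
     [M]. *)
  rewrite mulrACA -(powRM _ Y0 N0) -(powRM _ (ltW B0) MB0).
  rewrite (mulrC B) (divfK (lt0r_neq0 B0)).
  have -> : lpnorm 1%:E y / lpnorm p%:E y * opnorm A 1%:E q = gain A p%:E q y.
    by rewrite -yq /gain mulrC mulrA (divfK (lt0r_neq0 ny1)).
  have := ge0_ler_powR a0 (gain_ge0 A p%:E q y) M0 yM.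
  move=> /(ler_wpM2r (powR_ge0 M (2 * (p - 1) / p))) /le_trans; apply.
  by rewrite -powRD aE ?powRr1 ?oner_eq0.
have q1 := lt1 q q2; have p1 := ltW (lt1 p p2).
set M := max_nz _ _.
have gM x : x \in test_vectors A v -> x != 0 -> gain A p q x <= M.
  exact: le_max_nz.
have [B0 Bw] := base_factor_adjoint_le hA hj hv p1 q2 gM.
move: (base_factor A j v p q) B0 Bw => B B0 Bw.
have n_gt0 : (0 < n)%N by have /cV0Pn[[k kn] _] := v0; exact: leq_ltn_trans kn.
have D0 : 0 < n%:R `^ dim_exponent p :> R by rewrite powR_gt0 ?ltr0n.
rewrite mulrC -(ler_pdivlMr _ _ (mulr_gt0 D0 B0)).
apply: (opnorm_le v0 p1) => x.
have [w <- wq] := exists_norming (A *m x) q1.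
(* For [p >= 2], Cauchy-Schwarz separates [|z|_2], bounded by [M / B], from [|x|_2], bounded through
   the [p]-norm at the cost of a power of [n]. *)
rewrite dotc_mulmx; apply: le_trans (dotc_cauchy_schwarz _ _) _.
have alg (a b c d : R) : a * b * (c * d) = d * a * (c * b) by ring.
rewrite mulrAC (ler_pdivlMr _ _ (mulr_gt0 D0 B0)) alg.
apply: ler_pM (Bw w wq) (lpnorm2_le_lpnorm x n_gt0 p2).
  exact: mulr_ge0 (ltW B0) (lpnorm_ge0 _ _).
exact: mulr_ge0 (ltW D0) (lpnorm_ge0 _ _).
Qed.
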